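(* Let $K$ be a metric space, $n\ge1$, and let $K=K_0\supset\cdots\supset K_n$ be non-empty closed subsets of $K$ with $K_i$ nowhere dense in $K_{i-1}$ for all $1\le i\le n$; set $K_{n+1}=\emptyset$. Let $a_0,\dots,a_n$ be given real numbers, and let $f:K\to\mathbb{R}$ be the function with $f|(K_i\setminus K_{i+1})\equiv a_i$ for all $0\le i\le n$. Then $$\|f\|_D=\sum_{i=1}^n|a_i-a_{i-1}|+|a_n|\quad\text{and}\quad\|f\|_{qD}=\sum_{i=1}^n|a_i-a_{i-1}| .$$
   Context: $D(K)$ is the set of all $f:K\to\mathbb{C}$ of the form $f=(\varphi_1-\varphi_2)+i(\varphi_3-\varphi_4)$ with $\varphi_1,\dots,\varphi_4$ bounded real-valued lower semi-continuous functions on $K$. Equivalently, $f\in D(K)$ iff there is a sequence $(\varphi_j)$ of continuous complex-valued functions on $K$ with $\sup_{k\in K}\sum_j|\varphi_j(k)|<\infty$ and $f=\sum_j\varphi_j$ pointwise; $\|f\|_D$ is the infimum of $\sup_{k\in K}\sum_j|\varphi_j(k)|$ over all such sequences. $C_b(K)$ is the space of bounded continuous complex-valued functions on $K$, and for $f\in D(K)$, $\|f\|_{qD}=\inf_{\varphi\in C_b(K)}\|f-\varphi\|_D$. *)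

(* Defs.v *)
From HB Require Import structures.
From mathcomp Require Export all_boot all_order all_algebra.
From mathcomp Require Export complex.
From mathcomp Require Export all_classical all_reals all_analysis.
Export numFieldNormedType.Exports.
Export Order.TTheory GRing.Theory Num.Theory.

Set Implicit Arguments.
Unset Strict Implicit.
Unset Printing Implicit Defensive.

#[export] Set Implicit Arguments.
#[export] Unset Strict Implicit.
#[export] Unset Printing Implicit Defensive.

#[global] Open Scope classical_set_scope.
#[global] Open Scope ring_scope.

(* The topology and norm on R[i] are those of the regular module R[i]^o, whose
   norm takes values in R[i]; Normc.normc is the same modulus with values in R. *)
Section DSpace.
Context {R : realType} {K : topologicalType}.
Implicit Types (f : K -> R[i]) (phi : nat -> K -> R[i]^o).

Definition bounded_lsc (u : K -> R) : Prop :=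
  bounded_fun (u : K -> R^o) /\ lower_semicontinuous (EFin \o u).

Definition DK : set (K -> R[i]) := [set f |
  exists u1 u2 u3 u4 : K -> R,
    [/\ bounded_lsc u1, bounded_lsc u2, bounded_lsc u3, bounded_lsc u4 &
        f = fun k => ((u1 k - u2 k) +i* (u3 k - u4 k))%C]].

Definition abs_sum_sup phi : \bar R :=
  ereal_sup [set (\sum_(0 <= j <oo) (Normc.normc (phi j k))%:E)%E
             | k in [set: K]].

Definition D_series f : set (nat -> K -> R[i]^o) := [set phi |
  [/\ forall j, continuous (phi j),
      (abs_sum_sup phi < +oo)%E &
      forall k, series (fun j => phi j k) @ \oo --> (f k : R[i]^o)]].

(* The value is +oo when f is not in DK.  On an empty K, where ereal_sup set0
   is -oo, the value is -oo instead of 0. *)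
Definition Dnorm f : \bar R :=
  ereal_inf [set abs_sum_sup phi | phi in D_series f].

Definition Cb : set (K -> R[i]^o) :=
  [set phi | continuous phi /\ bounded_fun phi].

Definition qDnorm f : \bar R :=
  ereal_inf [set Dnorm (fun k => f k - phi k) | phi in Cb].

End DSpace.

(* Closure and interior are taken in the subspace topology of B.  The type
   subspace B also carries the points outside B, as isolated points, so this is
   the usual notion only for A `<=` B. *)
Definition nowhere_dense_in {T : topologicalType} (B A : set T) : Prop :=
  interior (closure (A : set (subspace B))) = set0.

(* Main.v *)
Require Import Defs.
From mathcomp Require Import ring lra.

(** Upper bounds: [f = a n + sum_(i < n) (a i - a i.+1) 1_(~ K_(i+1))], and the
    indicator of the open set [~ A] is the telescoping sum of the nonnegative
    continuous functions [ramp A j.+1 - ramp A j], where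
    [ramp A m k = min (1, m d(k, A))]; dropping the constant [a n] gives the
    bound for the quotient norm.

    Lower bounds: let [f - g = sum_j phi_j] with [g] continuous.  Start at a
    point of [K_n] and take a partial sum close to [f - g] there.  By continuity
    it stays close to [a n - g] at nearby points, and some of these lie in
    [K_(n-1) \ K_n], where a later partial sum is close to [a (n-1) - g]: the
    terms in between contribute about [|a n - a (n-1)|] to [sum_j |phi_j|].
    Descending to [K_0] collects all the jumps at a single point. *)

Lemma cvg_bigsum {K : numFieldType} {V : normedModType K} {T : Type}
    {F : set_system T} {FF : Filter F} (I : eqType) (r : seq I)
    (u : I -> T -> V) (l : I -> V) :
  (forall i, i \in r -> u i t @[t --> F] --> l i) ->
  \sum_(i <- r) u i t @[t --> F] --> \sum_(i <- r) l i.
Proof.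
elim: r => [_|i r IH ul].
  by rewrite big_nil; under eq_fun do rewrite big_nil; exact: cvg_cst.
rewrite big_cons; under eq_fun do rewrite big_cons.
apply: cvgD; first by apply: ul; rewrite mem_head.
by apply: IH => j jr; apply: ul; rewrite in_cons jr orbT.
Qed.

(** * The [R]-valued modulus on [R[i]] and limits *)

Section ComplexModulus.
Context {R : realType}.
Implicit Types z w : R[i].

Lemma norm_normc z : `|z| = (Normc.normc z)%:C%C.
Proof. by rewrite normc_def; case: z. Qed.

Lemma normc_ge0 z : 0 <= Normc.normc z.
Proof. by case: z => x y; rewrite sqrtr_ge0. Qed.

Lemma normc_real (x : R) : Normc.normc x%:C%C = `|x|.
Proof. by rewrite -sqrtr_sqr /Normc.normc /= expr0n addr0. Qed.

Lemma normc_distC z w : Normc.normc (z - w) = Normc.normc (w - z).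
Proof. by apply: complexI; rewrite -!norm_normc distrC. Qed.

Lemma normc_leB z w : Normc.normc z - Normc.normc w <= Normc.normc (z - w).
Proof. by rewrite -lecR rmorphB /= -!norm_normc lerB_dist. Qed.

Lemma normc_leD z w : Normc.normc (z + w) <= Normc.normc z + Normc.normc w.
Proof. exact: le_normcD. Qed.

Lemma normc_sum I (r : seq I) (P : pred I) (F : I -> R[i]) :
  Normc.normc (\sum_(i <- r | P i) F i) <= \sum_(i <- r | P i) Normc.normc (F i).
Proof.
rewrite -lecR rmorph_sum /= -norm_normc.
by apply: (le_trans (ler_norm_sum _ _ _)); apply: ler_sum => i _; rewrite norm_normc.
Qed.

(** A positive element of [R[i]] has zero imaginary part, so the [R[i]]-valued radii of the norm
    topology can be exchanged for real ones. *)
Lemma cvg_normcP {T : Type} {F : set_system T} {FF : Filter F}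
    (u : T -> R[i]^o) (l : R[i]^o) :
  (u @ F --> l) <->
  (forall e : R, 0 < e -> \forall t \near F, Normc.normc (l - u t) < e).
Proof.
split=> [ul e e0|ul].
  have ec : (0 : R[i]) < e%:C%C by rewrite ltcR.
  move/cvgrPdist_lt : ul => /(_ _ ec).
  by apply: filterS => t; rewrite norm_normc ltcR.
apply/cvgrPdist_lt => -[e e'] e0.
move: (e0); rewrite ltcE /= => /andP[/eqP e'0 {}e0]; subst e'.
by move: (ul _ e0); apply: filterS => t; rewrite norm_normc ltcR.
Qed.

Lemma cvg_real_complex {T : Type} {F : set_system T} {FF : Filter F}
    (u : T -> R) (l : R) :
  u @ F --> l -> (fun t => (u t)%:C%C : R[i]^o) @ F --> (l%:C%C : R[i]^o).
Proof.
move=> ul; apply/cvg_normcP => e e0.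
move/cvgrPdist_lt : ul => /(_ _ e0); apply: filterS => t.
by rewrite -rmorphB normc_real.
Qed.

Lemma cvg_normc {T : Type} {F : set_system T} {FF : Filter F}
    (u : T -> R[i]^o) (l : R[i]^o) :
  u @ F --> l -> Normc.normc (u t) @[t --> F] --> Normc.normc l.
Proof.
move=> /cvg_normcP ul; apply/cvgrPdist_lt => e e0.
move: (ul _ e0); apply: filterS => t; apply: le_lt_trans.
by rewrite ler_norml lerNl opprB {1}normc_distC !normc_leB.
Qed.

End ComplexModulus.

(** * Lower bound: collecting the jumps along the chain *)

Section LowerBound.
Context {R : realType} {K : topologicalType}.
Implicit Types phi : nat -> K -> R[i]^o.

Lemma abs_sum_le_sup phi m k :
  ((\sum_(0 <= j < m) Normc.normc (phi j k))%:E <= abs_sum_sup phi)%E.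
Proof.
rewrite -sumEFin; apply: le_trans (ereal_sup_ubound _); last by exists k.
by apply: nneseries_lim_ge => j _ _; rewrite lee_fin normc_ge0.
Qed.

(** If [U] missed [B] minus [A], then [B] would lie in [A] near [x], and [x] would be interior to
    the closure of [A] relative to [B]. *)
Lemma nowhere_dense_near (A B : set K) x (U : set K) :
  A `<=` B -> nowhere_dense_in B A -> A x -> nbhs x U ->
  exists2 y, U y & (B `\` A) y.
Proof.
move=> AB nd Ax Ux; apply: contrapT => h.
have : interior (closure (A : set (subspace B))) (x : subspace B).
  apply: (@filterS _ (nbhs (x : subspace B)) _ (A : set (subspace B))).
    exact: (@topology_structure.subset_closure (subspace B)).
  apply/(nbhs_subspace_ex _ (AB _ Ax)).
  (* Adding [A] to [U] gives a neighbourhood of [x] whose trace on [B] is exactly that of [A]. *)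
  exists (U `|` A); first by apply: filterS Ux => y; left.
  apply/seteqP; split => y /= [yA By]; split => //; first by right.
  by case: yA => // Uy; apply: contrapT => nAy; apply: h; exists y.
by rewrite nd.
Qed.

(** Keeping [g] general serves both norms: [g = 0] turns the first term into [|a n|], and for the
    quotient norm that term is dropped. *)
Lemma oscillation_le_sup n (Ki : nat -> set K) (a : nat -> R) phi
    (f g : K -> R[i]^o) (p : K) :
    (forall i, (i < n)%N -> Ki i.+1 `<=` Ki i) ->
    (forall i, (i < n)%N -> nowhere_dense_in (Ki i) (Ki i.+1)) ->
    (forall i, (i <= n)%N -> forall k, (Ki i `\` Ki i.+1) k ->
       f k = (a i)%:C%C) ->
    Ki n p -> ~ Ki n.+1 p ->
    continuous g -> D_series (fun k => f k - g k) phi ->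
  ((Normc.normc ((a n)%:C%C - g p) + \sum_(0 <= i < n) `|a i.+1 - a i|)%:E
    <= abs_sum_sup phi)%E.
Proof.
move=> sub nd fa Knp nKp cg [cphi _ sphi].
pose S m k := \sum_(0 <= j < m) phi j k : R[i]^o.
pose T m k := \sum_(0 <= j < m) Normc.normc (phi j k).
have cS m : continuous (S m).
  by move=> x; apply: cvg_bigsum => j _; exact: cphi.
(* The bound [M] forces the new partial sum to extend one already chosen. *)
have near_limit i k e M : (i <= n)%N -> (Ki i `\` Ki i.+1) k -> 0 < e ->
    exists2 m, (M <= m)%N & Normc.normc (S m k - ((a i)%:C%C - g k)) < e.
  move=> ni Kik e0.
  have /cvg_normcP/(_ _ e0) := sphi k; rewrite (fa _ ni _ Kik) => -[N _ HN].
  exists (maxn M N); first exact: leq_maxl.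
  by rewrite normc_distC; apply: HN => /=; exact: leq_maxr.
have T_block m m' k : (m <= m')%N ->
    T m k + Normc.normc (S m' k - S m k) <= T m' k.
  move=> mm'; rewrite /S (big_cat_nat (leq0n m) mm') /= addrAC subrr add0r.
  rewrite /T [leRHS](big_cat_nat (leq0n m) mm') /= lerD2l.
  exact: normc_sum.
(* Descent from [Ki n] to [Ki (n - d)]. The error [e] is quantified inside the induction, so a step
   may call the previous one with a smaller error. *)
have climb d : (d <= n)%N -> forall e, 0 < e -> exists k m,
    [/\ (Ki (n - d)%N `\` Ki (n - d).+1) k,
        Normc.normc (S m k - ((a (n - d)%N)%:C%C - g k)) < e &
        Normc.normc ((a n)%:C%C - g p) +
          \sum_(n - d <= i < n) `|a i.+1 - a i| - e < T m k].
  elim: d => [_ e e0|d IH dn e e0].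
    rewrite subn0; have [//|m _ me] := near_limit n p e 0%N (leqnn _) _ e0.
    exists p, m; split => //.
    (* [a n - g p] is within [e] of [S m p], whose modulus is at most [T m p]. *)
    rewrite big_geq // addr0 -(subKr (S m p) (_ - g p)).
    apply: (@lt_le_trans _ _ (Normc.normc (S m p))); last exact: normc_sum.
    rewrite ltrBlDr; apply: le_lt_trans (normc_leD _ _) _.
    by rewrite normcN ltrD2l.
  (* One third for the inherited deficit of [T m], one for [S m y] against [a i.+1 - g y], one for
     [S m' y] against [a i - g y]. *)
  have e30 : 0 < e / 3 by rewrite divr_gt0.
  have [k [m [[Kk _] Sk Tk]]] := IH (ltnW dn) _ e30.
  have ltn : (n - d.+1 < n)%N by rewrite ltn_subrL (leq_ltn_trans _ dn).
  have Snd : (n - d)%N = (n - d.+1).+1 by rewrite -subSn.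
  move: Kk Sk Tk; rewrite Snd; set i := (n - d.+1)%N in ltn * => Kk Sk Tk.
  have cSk : Normc.normc (S m y - ((a i.+1)%:C%C - g y)) @[y --> k] -->
      Normc.normc (S m k - ((a i.+1)%:C%C - g k)).
    apply: cvg_normc; apply: cvgB; first exact: cS.
    by apply: cvgB; [exact: cvg_cst | exact: cg].
  have cTk : T m y @[y --> k] --> T m k.
    by apply: cvg_bigsum => j _; apply: cvg_normc; exact: cphi.
  (* With [m] fixed, both inherited estimates are strict inequalities between functions continuous
     at [k], so they persist nearby. *)
  have nearK : nbhs k [set y |
      Normc.normc (S m y - ((a i.+1)%:C%C - g y)) < e / 3 /\
      Normc.normc ((a n)%:C%C - g p) +
        \sum_(i.+1 <= i < n) `|a i.+1 - a i| - e / 3 < T m y].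
    near=> y; split; near: y; first exact: cvgr_lt cSk _ Sk.
    exact: cvgr_gt cTk _ Tk.
  have [y [Sy Ty] Kiy] := nowhere_dense_near (sub _ ltn) (nd _ ltn) Kk nearK.
  have [m' mm' Sy'] := near_limit i y (e / 3) m (ltnW ltn) Kiy e30.
  exists y, m'; split => //; first by rewrite (lt_trans Sy') //; lra.
  have := T_block _ _ y mm'; apply: lt_le_trans.
  rewrite big_ltn //.
  (* Both partial sums are compared at the same point [y], so [g y] cancels and only the jump of [a]
     remains. *)
  have jump : `|a i.+1 - a i| <=
      Normc.normc (S m' y - S m y) + (Normc.normc (S m' y - ((a i)%:C%C - g y)) +
      Normc.normc (S m y - ((a i.+1)%:C%C - g y))).
    rewrite -normc_real rmorphB.
    have -> : (a i.+1)%:C%C - (a i)%:C%C =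
       - (S m' y - S m y) + ((S m' y - ((a i)%:C%C - g y)) -
         (S m y - ((a i.+1)%:C%C - g y))) :> R[i] by ring.
    apply: le_trans (normc_leD _ _) _; rewrite normcN lerD2l.
    by apply: le_trans (normc_leD _ _) _; rewrite normcN.
  lra.
apply/lee_subgt0Pr => e e0.
have [k [m [_ _ /ltW Tm]]] := climb n (leqnn n) e e0.
rewrite subnn in Tm.
by rewrite -EFinB; apply: le_trans (abs_sum_le_sup _ m k); rewrite lee_fin.
Unshelve. all: by end_near.
Qed.


End LowerBound.

(** * Upper bound: combinations of indicators of open sets *)

Section UpperBound.
Context {R : realType} {K : metricType R}.
Implicit Types (A : set K) (c : nat -> R).

(** [ramp] applies [fine], which sends [+oo] to 0; finiteness ensures that it sees the true
    distance. *)
Lemma edist_inf_fin_num A k : A !=set0 -> edist_inf A k \is a fin_num.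
Proof.
move=> [b Ab]; rewrite ge0_fin_numE ?edist_inf_ge0 //.
apply: (@le_lt_trans _ _ (edist (k, b))).
  by apply: ereal_inf_lbound; exists b.
rewrite -ge0_fin_numE ?edist_ge0 //; apply/edist_finP.
exists (mdist k b + 1); first by rewrite ltr_wpDl ?mdist_ge0.
by rewrite ballEmdist /= ltrDl.
Qed.

Lemma edist_inf_gt0 A k : closed A -> ~ A k -> (0 < edist_inf A k)%E.
Proof.
move=> cA nAk; rewrite lt_neqAle edist_inf_ge0 andbT; apply/eqP => k0.
have /nbhs_ballP[e /= e0 ke] : nbhs k (~` A).
  by apply: open_nbhs_nbhs; split => //; exact: closed_openC.
have /ereal_inf_lt[_ [b Ab <-] kb] : (edist_inf A k < e%:E)%E.
  by rewrite -k0 lte_fin.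
by apply: (ke b) Ab; exact: (@edist_lt_ball R K e (k, b)).
Qed.

Definition ramp A (m : nat) (k : K) : R :=
  Num.min 1 (m%:R * fine (edist_inf A k)).

Lemma ramp_continuous A m : A !=set0 -> continuous (ramp A m).
Proof.
move=> A0 k; apply: (@continuous_min R K (fun=> 1)); first exact: cvg_cst.
apply: (@cvgM R K (nbhs k)); first exact: cvg_cst.
apply: fine_cvg; rewrite fineK; first exact: edist_inf_continuous.
exact: edist_inf_fin_num.
Qed.

Lemma ramp0 A k : ramp A 0 k = 0.
Proof. by rewrite /ramp mul0r min_r. Qed.

Lemma ramp_le1 A m k : ramp A m k <= 1.
Proof. by rewrite /ramp ge_min lexx. Qed.

Lemma ramp_leS A m k : ramp A m k <= ramp A m.+1 k.
Proof.
have d0 : 0 <= fine (edist_inf A k) by rewrite fine_ge0 ?edist_inf_ge0.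
rewrite /ramp le_min ge_min lexx /= ge_min; apply/orP; right.
by apply: ler_wpM2r => //; rewrite ler_nat.
Qed.

(** The sequence is eventually constant: on [A] the distance is 0, and off the closed set [A] it is
    positive, so [m] times it eventually exceeds 1. *)
Lemma ramp_cvg A k : closed A -> A !=set0 ->
  ramp A m k @[m --> \oo] --> (\1_(~` A) k : R).
Proof.
move=> cA A0; rewrite indicE in_setC.
have [/set_mem Ak|/negP nAk] := boolP (k \in A); rewrite /ramp.
  rewrite edist_inf0 // fine0; under eq_fun do rewrite mulr0 min_r //.
  exact: cvg_cst.
have d0 : 0 < fine (edist_inf A k).
  rewrite -lte_fin fineK ?edist_inf_fin_num //; apply: edist_inf_gt0 => // Ak.
  by apply: nAk; exact: mem_set.
apply: cvg_near_cst; near=> m; apply: min_l.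
rewrite -ler_pdivrMr //; near: m; exact: nbhs_infty_ger.
Unshelve. all: by end_near. Qed.

Lemma indicC_sum_lsc n (c0 : R) c (A : nat -> set K) :
  (forall i, (i < n)%N -> 0 <= c i) -> (forall i, (i < n)%N -> closed (A i)) ->
  bounded_lsc (fun k => c0 + \sum_(0 <= i < n) c i * \1_(~` A i) k).
Proof.
move=> cge0 cA; split.
  exists (`|c0| + \sum_(0 <= i < n) `|c i|); split; first exact: num_real.
  move=> M /ltW MB k _; apply: le_trans MB.
  apply: (le_trans (ler_normD _ _)); rewrite lerD2l.
  apply: (le_trans (ler_norm_sum _ _ _)); apply: ler_sum => i _.
  by rewrite normrM ler_piMr // indicE; case: (_ \in _); rewrite ?normr0 ?normr1.
move=> x r rx.
(* More than semicontinuity holds: near [x] the sum never drops below its value at [x], since each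
   indicator of an open set has this property and the weights are nonnegative. *)
exists [set y | c0 + \sum_(0 <= i < n) c i * \1_(~` A i) x <=
                c0 + \sum_(0 <= i < n) c i * \1_(~` A i) y]; last first.
  by move=> y /= xy; apply: lt_le_trans rx _; rewrite lee_fin.
suff : \forall y \near x, \sum_(0 <= i < n) c i * \1_(~` A i) x <=
    \sum_(0 <= i < n) c i * \1_(~` A i) y.
  by apply: filterS => y xy /=; rewrite lerD2l.
clear r rx.
elim: n cge0 cA => [|n IH] cge0 cA.
  by apply: nearW => y; rewrite !big_geq.
have near_x : \forall y \near x, \1_(~` A n) x <= \1_(~` A n) y :> R.
  have [Ax|nAx] := pselect (A n x).
    by apply: nearW => y; rewrite indicE memNset // indicE ler0n.
  have : nbhs x (~` A n).
    by apply: open_nbhs_nbhs; split => //; apply: closed_openC; exact: cA.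
  by apply: filterS => y nAy; rewrite !indicE !mem_set.
have {}IH := IH (fun i h => cge0 _ (ltnW h)) (fun i h => cA _ (ltnW h)).
apply: filterS2 IH near_x => y xy xyn; rewrite !big_nat_recr //= lerD //.
by rewrite ler_wpM2l // cge0.
Qed.

(** Splitting each [c i] into positive and negative parts gives a difference of two sums with
    nonnegative weights. *)
Lemma indicC_sum_DK n (c0 : R) c (A : nat -> set K) :
  (forall i, (i < n)%N -> closed (A i)) ->
  DK (fun k => (c0 + \sum_(0 <= i < n) c i * \1_(~` A i) k)%:C%C).
Proof.
move=> cA.
exists (fun k => c0 + \sum_(0 <= i < n) Num.max (c i) 0 * \1_(~` A i) k).
exists (fun k => 0 + \sum_(0 <= i < n) Num.max (- c i) 0 * \1_(~` A i) k).
have lsc0 : bounded_lsc (fun _ : K => 0 : R).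
  have : bounded_lsc (fun k => 0 + \sum_(0 <= i < 0) c i * \1_(~` A i) k).
    exact: indicC_sum_lsc.
  by under eq_fun do rewrite big_geq // addr0.
exists (fun=> 0), (fun=> 0); split => //.
- by apply: indicC_sum_lsc => // i _; rewrite le_max lexx orbT.
- by apply: indicC_sum_lsc => // i _; rewrite le_max lexx orbT.
apply/funext => k; rewrite subrr add0r -addrA -sumrB; congr ((_ + _)%:C%C).
apply: eq_bigr => i _; rewrite -mulrBl; congr (_ * _).
by rewrite /Num.max; case: ltP => ?; case: ltP => ?; lra.
Qed.

Lemma indicC_sum_Dnorm_le n (c0 : R) c (A : nat -> set K) :
  (forall i, (i < n)%N -> closed (A i) /\ A i !=set0) ->
  (Dnorm (fun k => (c0 + \sum_(0 <= i < n) c i * \1_(~` A i) k)%:C%C) <=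
    (`|c0| + \sum_(0 <= i < n) `|c i|)%:E)%E.
Proof.
move=> cA.
(* The constant [c0] is carried by the term of index 0 alone; the rest are ramp increments. *)
pose term j k := (j == 0%N)%:R * c0 +
  \sum_(0 <= i < n) c i * (ramp (A i) j.+1 k - ramp (A i) j k).
pose phi j k : R[i]^o := (term j k)%:C%C.
have mem_n i : i \in index_iota 0 n -> (i < n)%N by rewrite mem_index_iota.
have sum_term m k : \sum_(0 <= j < m.+1) term j k =
    c0 + \sum_(0 <= i < n) c i * ramp (A i) m.+1 k.
  rewrite big_split /= big_nat_recl //= mul1r big1 ?addr0 => [|j _]; last first.
    by rewrite mul0r.
  rewrite exchange_big /=; congr (_ + _); apply: eq_bigr => i _.
  by rewrite -mulr_sumr telescope_sumr // ramp0 subr0.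
(* Ramp increments are nonnegative, so the absolute values telescope too, each ramp contributing at
   most [|c i|]. *)
have sum_abs m k : \sum_(0 <= j < m) Normc.normc (phi j k) <=
    `|c0| + \sum_(0 <= i < n) `|c i|.
  apply: (@le_trans _ _ (\sum_(0 <= j < m) ((j == 0%N)%:R * `|c0| +
     \sum_(0 <= i < n) `|c i| * (ramp (A i) j.+1 k - ramp (A i) j k)))).
    apply: ler_sum => j _; rewrite normc_real.
    apply: le_trans (ler_normD _ _) _; rewrite normrM normr_nat lerD2l.
    apply: le_trans (ler_norm_sum _ _ _) _; apply: ler_sum => i _.
    by rewrite normrM [X in _ * X]ger0_norm // subr_ge0 ramp_leS.
  rewrite big_split /= lerD //.
    case: m => [|m]; first by rewrite big_geq.
    by rewrite big_nat_recl //= mul1r big1 ?addr0 // => j _; rewrite mul0r.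
  rewrite exchange_big /=; apply: ler_sum => i _.
  by rewrite -mulr_sumr telescope_sumr // ramp0 subr0 ler_piMr // ramp_le1.
have sup_le : (abs_sum_sup phi <= (`|c0| + \sum_(0 <= i < n) `|c i|)%:E)%E.
  apply: ge_ereal_sup => _ [k _ <-]; apply: lime_le.
    by apply: is_cvg_nneseries => j _ _; rewrite lee_fin normc_ge0.
  by apply: nearW => m; rewrite sumEFin lee_fin sum_abs.
apply: (le_trans _ sup_le); apply: ereal_inf_lbound; exists phi => //; split.
- move=> j x; apply: cvg_real_complex; apply: cvgD; first exact: cvg_cst.
  apply: cvg_bigsum => i /mem_n /cA[_ Ai]; apply: cvgM; first exact: cvg_cst.
  by apply: cvgB; exact: ramp_continuous.
- by rewrite (le_lt_trans sup_le) // ltry.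
(* The closed form of the partial sums includes [c0] and thus needs at least one term, hence the
   shift. *)
- move=> k; rewrite -cvg_shiftS.
  have -> : [sequence series (fun j => phi j k) m.+1]_m =
      fun m => (c0 + \sum_(0 <= i < n) c i * ramp (A i) m.+1 k)%:C%C.
    by apply/funext => m; rewrite -sum_term rmorph_sum.
  apply: cvg_real_complex; apply: cvgD; first exact: cvg_cst.
  apply: cvg_bigsum => i /mem_n /cA[cAi Ai]; apply: cvgM; first exact: cvg_cst.
  by rewrite (cvg_shiftS (fun m => ramp (A i) m k)); exact: ramp_cvg.
Qed.

End UpperBound.

(** At a point of [Ki j] outside [Ki j.+1], the indicators equal to 1 are those with [i >= j], and
    their weights telescope to [a j - a n]. *)
Lemma chain_indicC_sum {R : realType} {K : Type} n (Ki : nat -> set K)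
    (a : nat -> R) (f : K -> R) :
    (forall i, (i < n)%N -> Ki i.+1 `<=` Ki i) ->
    Ki n.+1 = set0 ->
    (forall i, (i <= n)%N -> forall k, (Ki i `\` Ki i.+1) k -> f k = a i) ->
  forall k, Ki 0%N k ->
  f k = a n + \sum_(0 <= i < n) (a i - a i.+1) * \1_(~` Ki i.+1) k.
Proof.
move=> sub Kn fa k.
have Kle i j : (i <= j <= n)%N -> Ki j `<=` Ki i.
  elim: j => [|j IH]; first by rewrite leqn0 => /andP[/eqP -> _] x.
  case/andP; rewrite leq_eqVlt => /predU1P[-> _ x //|ij] jn.
  by apply: subset_trans (sub _ jn) (IH _); rewrite -ltnS ij ltnW.
suff H d : (d <= n)%N -> Ki (n - d)%N k ->
    f k = a n + \sum_(n - d <= i < n) (a i - a i.+1) * \1_(~` Ki i.+1) k.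
  by move: (H n (leqnn _)); rewrite subnn.
elim: d => [_|d IH dn Kk].
  rewrite subn0 big_geq // addr0 => Kk.
  by apply: fa => //; split => //; rewrite Kn.
have ltn : (n - d.+1 < n)%N by rewrite ltn_subrL (leq_ltn_trans _ dn).
have Snd : (n - d.+1).+1 = (n - d)%N by rewrite -subSn.
(* Inside the next set the leading indicator vanishes and induction applies; outside it, all
   remaining indicators are 1. *)
have [Kk'|nKk'] := pselect (Ki (n - d)%N k).
  rewrite big_ltn // Snd indicE memNset ?mulr0 ?add0r; last by move=> /(_ Kk').
  exact: IH (ltnW dn) Kk'.
have eqa : \sum_(n - d.+1 <= i < n) (a i - a i.+1) * \1_(~` Ki i.+1) k =
    \sum_(n - d.+1 <= i < n) - (a i.+1 - a i).
  apply: eq_big_nat => i /andP[di ni]; rewrite opprB indicE mem_set ?mulr1 //.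
  by move=> Ki1; apply: nKk'; apply: (Kle _ i.+1) Ki1; rewrite -Snd ltnS di.
rewrite eqa sumrN telescope_sumr ?leq_subr // opprB addrC subrK.
by apply: fa; rewrite ?leq_subr // Snd.
Qed.

(** * The two norms of [f] *)

Theorem proposition3p11 (R : realType) (K : metricType R) (n : nat)
    (hn : (1 <= n)%N)
    (Ki : nat -> set K)
    (hK0 : Ki 0%N = [set: K])
    (hdecr : forall i, (1 <= i <= n)%N -> Ki i `<=` Ki i.-1)
    (hnonempty : forall i, (i <= n)%N -> Ki i !=set0)
    (hclosed : forall i, (i <= n)%N -> closed (Ki i))
    (hnowhere : forall i, (1 <= i <= n)%N -> nowhere_dense_in (Ki i.-1) (Ki i))
    (hlast : Ki n.+1 = set0)
    (a : nat -> R) (f : K -> R)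
    (hf : forall i, (i <= n)%N -> forall k, (Ki i `\` Ki i.+1) k -> f k = a i) :
  let F : K -> R[i] := fun k => (f k)%:C%C in
  [/\ F \in DK,
      Dnorm F = (\sum_(1 <= i < n.+1) `|a i - a i.-1| + `|a n|)%:E &
      qDnorm F = (\sum_(1 <= i < n.+1) `|a i - a i.-1|)%:E].
Proof.
move=> F.
have sub i : (i < n)%N -> Ki i.+1 `<=` Ki i by exact: (hdecr i.+1).
have nd i : (i < n)%N -> nowhere_dense_in (Ki i) (Ki i.+1).
  exact: (hnowhere i.+1).
have [p Kp] := hnonempty n (leqnn n).
have nKp : ~ Ki n.+1 p by rewrite hlast.
have Fa i : (i <= n)%N -> forall k, (Ki i `\` Ki i.+1) k -> F k = (a i)%:C%C.
  by move=> ni k /(hf _ ni) fk; rewrite /F fk.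
have fE k : f k = a n + \sum_(0 <= i < n) (a i - a i.+1) * \1_(~` Ki i.+1) k.
  by apply: chain_indicC_sum => //; rewrite hK0.
have ge_sup (g : K -> R[i]^o) : continuous g ->
    ((Normc.normc ((a n)%:C%C - g p) + \sum_(0 <= i < n) `|a i.+1 - a i|)%:E <=
      Dnorm (fun k => (F k - g k)%R))%E.
  move=> cg; apply: le_ereal_inf_tmp => _ [phi Dphi <-].
  exact: (@oscillation_le_sup _ _ n Ki a phi F g p).
have le_sup c0 : (Dnorm (fun k => (c0 + \sum_(0 <= i < n)
    (a i - a i.+1) * \1_(~` Ki i.+1) k)%:C%C) <=
    (`|c0| + \sum_(0 <= i < n) `|a i.+1 - a i|)%:E)%E.
  under [in leRHS]eq_bigr do rewrite distrC.
  apply: (@indicC_sum_Dnorm_le _ _ n c0 (fun i => a i - a i.+1)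
    (fun i => Ki i.+1)).
  by move=> i ni; split; [exact: hclosed | exact: hnonempty].
have FE : F = fun k => (a n + \sum_(0 <= i < n)
    (a i - a i.+1) * \1_(~` Ki i.+1) k)%:C%C.
  by apply/funext => k; rewrite /F fE.
rewrite big_add1 /=; split.
- rewrite inE FE.
  apply: (@indicC_sum_DK _ _ n (a n) (fun i => a i - a i.+1)
    (fun i => Ki i.+1)).
  by move=> i ni; exact: hclosed.
- apply/eqP; rewrite eq_le addrC {1}FE le_sup /=.
  (* The lower bound with [g = 0]. *)
  have /ge_sup : continuous (fun _ : K => 0 : R[i]^o) by move=> x; exact: cvg_cst.
  rewrite subr0 normc_real; congr (_ <= Dnorm _)%E.
  by apply/funext => k; rewrite subr0.
- apply/eqP; rewrite eq_le; apply/andP; split.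
    apply: ereal_inf_le.
    (* Subtracting the constant [a n] leaves the indicator sum with [c0 = 0], so this constant
       attains the quotient norm. *)
    exists (Dnorm (fun k => F k - (a n)%:C%C)); last first.
      have -> : (fun k => F k - (a n)%:C%C) = fun k => (0 + \sum_(0 <= i < n)
          (a i - a i.+1) * \1_(~` Ki i.+1) k)%:C%C.
        by apply/funext => k; rewrite FE -rmorphB addrAC subrr.
      by apply: le_trans (le_sup 0) _; rewrite normr0 add0r.
    exists (fun=> (a n)%:C%C) => //; split; first by move=> x; exact: cvg_cst.
    exists (`|(a n)%:C%C|); split; first exact: normr_real.
    by move=> M /ltW aM k _.
  apply: le_ereal_inf_tmp => _ [g [cg _] <-]; apply: le_trans (ge_sup g cg).
  by rewrite lee_fin lerDr normc_ge0.
Qed.
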